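(* Let $(P,\cdot)$ be a polygroupoid, and put $$N^1_{\rho}(P,\cdot)=\{a\in P \mid (x\cdot y)\cdot a=x\cdot(y\cdot a)\ \ \forall\, x,y\in P\},$$ $$N^2_{\rho}(P,\cdot)=\{a\in P \mid (X\cdot y)\cdot a=X\cdot(y\cdot a)\ \ \forall\, X\subseteq P,\ y\in P\},$$ $$N^3_{\rho}(P,\cdot)=\{a\in P \mid (x\cdot Y)\cdot a=x\cdot(Y\cdot a)\ \ \forall\, x\in P,\ Y\subseteq P\},$$ $$N^4_{\rho}(P,\cdot)=\{a\in P \mid (X\cdot Y)\cdot a=X\cdot(Y\cdot a)\ \ \forall\, X,Y\subseteq P\}.$$ Then the following are true: (a) $N^1_{\rho}(P,\cdot)\subseteq N^2_{\rho}(P,\cdot)$; (b) $N^1_{\rho}(P,\cdot)\subseteq N^3_{\rho}(P,\cdot)$; (c) $N^1_{\rho}(P,\cdot)\subseteq N^4_{\rho}(P,\cdot)$; (d) $N^2_{\rho}(P,\cdot)\subseteq N^4_{\rho}(P,\cdot)$; (e) $N^3_{\rho}(P,\cdot)\subseteq N^4_{\rho}(P,\cdot)$.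
   Context: A polygroupoid (also called a hypergroupoid) is a pair $(P,\cdot)$ where $P$ is a non-empty set and $\cdot: P\times P\to\mathcal{P}^{*}(P)$ is a hyperoperation, $\mathcal{P}^{*}(P)$ being the family of non-empty subsets of $P$. The hyperoperation is extended to subsets $A,B\subseteq P$ by $A\cdot B=\bigcup_{a\in A,\,b\in B} a\cdot b$, and an element $x\in P$ occurring in a product with a subset is identified with the singleton $\{x\}$; thus for $a,x,y\in P$, $(x\cdot y)\cdot a=\bigcup_{b\in x\cdot y} b\cdot a$ and $x\cdot(y\cdot a)=\bigcup_{w\in y\cdot a} x\cdot w$. The set $N^i_{\rho}(P,\cdot)$, $i=1,2,3,4$, is called the first, second, third, fourth right nucleus of $(P,\cdot)$, respectively. *)

(* Defs.v *)
From mathcomp Require Import all_boot.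
From mathcomp Require Import boolp classical_sets.

Set Implicit Arguments.
Unset Strict Implicit.
Unset Printing Implicit Defensive.

Local Open Scope classical_set_scope.

Record polygroupoid : Type := Polygroupoid {
  carrier :> Type;
  hop : carrier -> carrier -> set carrier;
  carrier_nonempty : [set: carrier] !=set0;
  hop_nonempty : forall x y : carrier, hop x y !=set0
}.

Definition hop_set (P : polygroupoid) (A B : set P) : set P :=
  \bigcup_(a in A) \bigcup_(b in B) hop a b.

Declare Scope hyperop_scope.
Notation "x ** y" := (hop x y) (at level 40, left associativity)
  : hyperop_scope.
Notation "A `** B" := (hop_set A B) (at level 40, left associativity)
  : hyperop_scope.
Local Open Scope hyperop_scope.

(* An element multiplied with a subset is written as an explicit singleton.
   The subsets X and Y below range over all subsets, the empty one included. *)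

Definition right_nucleus1 (P : polygroupoid) : set P :=
  [set a | forall x y : P, (x ** y) `** [set a] = [set x] `** (y ** a)].

Definition right_nucleus2 (P : polygroupoid) : set P :=
  [set a | forall (X : set P) (y : P),
     (X `** [set y]) `** [set a] = X `** (y ** a)].

Definition right_nucleus3 (P : polygroupoid) : set P :=
  [set a | forall (x : P) (Y : set P),
     ([set x] `** Y) `** [set a] = [set x] `** (Y `** [set a])].

Definition right_nucleus4 (P : polygroupoid) : set P :=
  [set a | forall X Y : set P,
     (X `** Y) `** [set a] = X `** (Y `** [set a])].

Arguments right_nucleus1 P : clear implicits.
Arguments right_nucleus2 P : clear implicits.
Arguments right_nucleus3 P : clear implicits.
Arguments right_nucleus4 P : clear implicits.

(* Main.v *)
Require Import Defs.
From mathcomp Require Import all_boot.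
From mathcomp Require Import boolp classical_sets.

(** The extension of the hyperoperation to subsets is defined by unions, so it
    distributes over arbitrary unions in each argument ([hop_set_bigcupl],
    [hop_set_bigcupr]).  Writing [X] and [Y] as unions of singletons therefore
    reduces the identity for all subsets to the identity for all elements,
    which gives the inclusion of the first nucleus in the fourth
    ([right_nucleus1_sub4]).  Conversely, the identities defining the second
    and third nuclei are instances of the one defining the fourth, and
    specialize in turn to the one defining the first.  Hence the four nuclei
    coincide, and each inclusion is a composite of these.  Empty subsets are
    harmless, since they correspond to empty unions. *)

Local Open Scope classical_set_scope.
Local Open Scope hyperop_scope.

Section HyperoperationOnSubsets.
Context {P : polygroupoid}.
Implicit Types (x y a : P) (X Y A B : set P).

Lemma hop_set11 x y : [set x] `** [set y] = x ** y.
Proof. by rewrite /hop_set !bigcup_set1. Qed.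

Lemma hop_set_bigcupl I (D : set I) (F : I -> set P) B :
  (\bigcup_(i in D) F i) `** B = \bigcup_(i in D) (F i `** B).
Proof.
apply/seteqP; split=> z.
- by move=> [x [i Di Fix] xBz]; exists i => //; exists x.
- by move=> [i Di [x Fix xBz]]; exists x => //; exists i.
Qed.

Lemma hop_set_bigcupr I (D : set I) A (F : I -> set P) :
  A `** (\bigcup_(i in D) F i) = \bigcup_(i in D) (A `** F i).
Proof.
apply/seteqP; split=> z.
- by move=> [x Ax [y [i Di Fiy] xyz]]; exists i => //; exists x => //; exists y.
- by move=> [i Di [x Ax [y Fiy xyz]]]; exists x => //; exists y => //; exists i.
Qed.

Lemma hop_set_bigcup1l A B : A `** B = \bigcup_(x in A) ([set x] `** B).
Proof. by apply: eq_bigcupr => x _; rewrite /hop_set bigcup_set1. Qed.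

Lemma hop_set1r A y : A `** [set y] = \bigcup_(x in A) (x ** y).
Proof.
by rewrite hop_set_bigcup1l; apply: eq_bigcupr => x _; rewrite hop_set11.
Qed.

End HyperoperationOnSubsets.

Section RightNuclei.
Variable P : polygroupoid.

Lemma right_nucleus1_sub4 : right_nucleus1 P `<=` right_nucleus4 P.
Proof.
move=> a N1a X Y.
rewrite {2}/hop_set hop_set_bigcupl [RHS]hop_set_bigcup1l.
apply: eq_bigcupr => x _.
rewrite hop_set_bigcupl hop_set1r hop_set_bigcupr.
by apply: eq_bigcupr => y _; apply: N1a.
Qed.

Lemma right_nucleus4_sub2 : right_nucleus4 P `<=` right_nucleus2 P.
Proof. by move=> a N4a X y; rewrite N4a hop_set11. Qed.

Lemma right_nucleus4_sub3 : right_nucleus4 P `<=` right_nucleus3 P.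
Proof. by move=> a N4a x Y; apply: N4a. Qed.

Lemma right_nucleus2_sub1 : right_nucleus2 P `<=` right_nucleus1 P.
Proof. by move=> a N2a x y; rewrite -N2a hop_set11. Qed.

Lemma right_nucleus3_sub1 : right_nucleus3 P `<=` right_nucleus1 P.
Proof. by move=> a N3a x y; rewrite -!hop_set11 N3a. Qed.

End RightNuclei.

Local Close Scope hyperop_scope.

Theorem theorem3p3 (P : polygroupoid) :
  [/\ right_nucleus1 P `<=` right_nucleus2 P,
      right_nucleus1 P `<=` right_nucleus3 P,
      right_nucleus1 P `<=` right_nucleus4 P,
      right_nucleus2 P `<=` right_nucleus4 P &
      right_nucleus3 P `<=` right_nucleus4 P].
Proof.
split.
- exact: subset_trans (@right_nucleus1_sub4 P) (@right_nucleus4_sub2 P).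
- exact: subset_trans (@right_nucleus1_sub4 P) (@right_nucleus4_sub3 P).
- exact: right_nucleus1_sub4.
- exact: subset_trans (@right_nucleus2_sub1 P) (@right_nucleus1_sub4 P).
- exact: subset_trans (@right_nucleus3_sub1 P) (@right_nucleus1_sub4 P).
Qed.
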